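(* Let $X$ be a Hilbert space and let $\mathcal{H}$ be a locally finite weight in $X$ with corresponding subspaces $(X_n)_{n\in\mathbb{N}}$, and let $P_n\in L(X)$ be the orthogonal projection onto $X_n$. Let $H\colon D(H)\subseteq X\to X$ be linear, densely defined and satisfy $P_nH\subseteq HP_n$ for all $n\in\mathbb{N}$. Assume that $H$ leaves every $X_n$ invariant, i.e. $H(D(H)\cap X_n)\subseteq X_n$. Then $$(H\mathcal{H})^{\star}=\overline{H^{\star}\mathcal{H}},$$ where the adjoint on the left is taken with respect to $X_{\mathcal{H}}$, the adjoint $H^{\star}$ on the right is taken with respect to $X$, and $H\mathcal{H}$, $H^{\star}\mathcal{H}$ are regarded as operators in $X_{\mathcal{H}}$.
   Context: A self-adjoint operator $\mathcal{H}$ in $X$ is a locally finite weight if there is an increasing sequence $(X_n)_{n\in\mathbb{N}}$ of closed subspaces of $X$ (the corresponding subspaces) such that (a) for every $n$, $X_n\subseteq D(\mathcal{H})$, $\mathcal{H}$ maps $X_n$ into $X_n$, and $\mathcal{H}_n\colon X_n\to X_n$, $x\mapsto\mathcal{H}x$, is bounded with $\mathcal{H}_n\geqslant c_n>0$ (in the sense of positive definiteness) for some constant $c_n$; (b) $\mathcal{H}|_{\bigcup_{n}X_n}$ is essentially self-adjoint in $X$. $X_{\mathcal{H}}$ denotes the completion of $\bigcup_{n}X_n$ with respect to the scalar product $\langle\cdot,\mathcal{H}\cdot\rangle_X$; its elements are represented by Cauchy sequences in $(\bigcup_nX_n,\langle\cdot,\mathcal{H}\cdot\rangle)$. The map $P\colon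 D(\mathcal{H})\to X_{\mathcal{H}}$, $Px=(P_nx)_{n\in\mathbb{N}}$, is well defined and injective. For $K\in\{H,H^{\star}\}$ the operator $K\mathcal{H}\colon D(K\mathcal{H})\subseteq X_{\mathcal{H}}\to X_{\mathcal{H}}$ is defined by $$D(K\mathcal{H})=\{\tilde{x}\in X_{\mathcal{H}}:\exists\,x\in D(\mathcal{H})\colon Px=\tilde{x},\ \mathcal{H}x\in D(K)\text{ and }(P_nK\mathcal{H}x)_{n\in\mathbb{N}}\in X_{\mathcal{H}}\},\quad K\mathcal{H}\tilde{x}=(P_nK\mathcal{H}x)_{n\in\mathbb{N}},$$ where ''$(P_nK\mathcal{H}x)_n\in X_{\mathcal{H}}$'' means that this sequence is Cauchy in $(\bigcup_nX_n,\langle\cdot,\mathcal{H}\cdot\rangle)$. The closure is taken in $X_{\mathcal{H}}$. *)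

(* Defs.v *)
From HB Require Import structures.
From mathcomp Require Import all_boot all_order all_algebra.
From mathcomp Require Import complex.
From mathcomp Require Import all_classical all_reals all_analysis.

Set Implicit Arguments.
Unset Strict Implicit.
Unset Printing Implicit Defensive.

Import Order.TTheory GRing.Theory Num.Theory.
Import numFieldNormedType.Exports.

Local Open Scope classical_set_scope.
Local Open Scope ring_scope.

(* Hilbert spaces are real or complex; the two cases are treated uniformly. *)
Variant scalars := RealScalars | ComplexScalars.

Definition scalar_field (R : realType) (s : scalars) : numFieldType :=
  match s with
  | RealScalars => R
  | ComplexScalars => R[i]
  end.

Definition scalar_conj (R : realType) (s : scalars) :
    scalar_field R s -> scalar_field R s :=
  match s with
  | RealScalars => fun a => a
  | ComplexScalars => fun a => conjc a
  end.

(* The inner product is linear in its first and conjugate-linear in its second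
   argument. *)
HB.mixin Record CompleteNormedModule_isHilbert (R : realType) (s : scalars) X
    of CompleteNormedModule (scalar_field R s) X := {
  inner : {dot X for @scalar_conj R s} ;
  sqr_norm_inner : forall x : X, `|x| ^+ 2 = inner x x
}.

#[short(type="hilbertType")]
HB.structure Definition Hilbert (R : realType) (s : scalars) :=
  {X of CompleteNormedModule_isHilbert R s X
      & CompleteNormedModule (scalar_field R s) X}.

Definition is_subspace (K : numFieldType) (E : lmodType K) (V : set E) :=
  V 0 /\ forall (a : K) x y, V x -> V y -> V (a *: x + y).

(* Unbounded operators are identified with their graphs: (x, y) belongs to A
   iff x is in the domain of A and A x = y.  Equality of operators, with equal
   domains, is then equality of sets, and the closure of an operator is the
   topological closure of its graph in X * X. *)
Section Operators.
Context {R : realType} {s : scalars} {X : hilbertType R s}.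
Implicit Types (A : set (X * X)) (V : set X).

Definition dom A : set X := fst @` A.

Definition linear_operator A :=
  is_subspace A /\ forall y, A (0, y) -> y = 0.

Definition densely_defined A := dense (dom A).

(* This is (the graph of) an operator exactly when A is densely defined. *)
Definition adjoint A : set (X * X) :=
  [set p | forall x y, A (x, y) -> inner y p.1 = inner x p.2].

Definition self_adjoint A :=
  [/\ linear_operator A, densely_defined A & adjoint A = A].

Definition essentially_self_adjoint A := self_adjoint (closure A).

Definition restriction A V : set (X * X) := [set p | A p /\ V p.1].

Definition orthogonal_projection V (P : X -> X) :=
  forall x, V (P x) /\ forall y, V y -> inner (x - P x) y = 0.

Definition locally_finite_weight A (V : nat -> set X) :=
  self_adjoint A /\
  [/\ forall n, is_subspace (V n) /\ closed (V n),
      forall n, V n `<=` V n.+1,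
      forall n, V n `<=` dom A /\ (forall x y, A (x, y) -> V n x -> V n y),
      forall n, (exists M : scalar_field R s,
                   forall x y, A (x, y) -> V n x -> `|y| <= M * `|x|) /\
                (exists2 c : scalar_field R s, 0 < c &
                   forall x y, A (x, y) -> V n x -> c * inner x x <= inner x y)
    & essentially_self_adjoint (restriction A (\bigcup_n V n))].

End Operators.

Section Completion.
Context {R : realType} {s : scalars} {X Y : hilbertType R s}.
Implicit Types (A K : set (X * X)) (U : set X) (iota : X -> Y).

(* The Hilbert space Y, with the embedding iota of U (whose values outside U
   are irrelevant), is a completion of U for the product (x, y) |-> <x, A y>. *)
Definition weighted_completion A U iota :=
  [/\ forall (a : scalar_field R s) x y, U x -> U y ->
        iota (a *: x + y) = a *: iota x + iota y,
      forall x y z, U x -> U y -> A (y, z) ->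
        inner (iota x) (iota y) = inner x z
    & dense (iota @` U)].

(* The element of the completion represented by a sequence u in U is the limit
   of its image; as iota is isometric, this limit exists iff u is Cauchy in U
   for the weighted product. *)
Definition represents U iota (u : nat -> X) (y : Y) :=
  (forall n, U (u n)) /\ (iota \o u) @ \oo --> y.

(* The operator K A in the completion of the union of the V n; P n is the
   orthogonal projection onto V n. *)
Definition weighted_operator A (V : nat -> set X) (P : nat -> X -> X) iota K :
    set (Y * Y) :=
  [set p | exists x y z, [/\ A (x, y), K (y, z),
     represents (\bigcup_n V n) iota (fun n => P n x) p.1
   & represents (\bigcup_n V n) iota (fun n => P n z) p.2]].

End Completion.

(* Main.v *)
Require Import Defs.
From HB Require Import structures.
From mathcomp Require Import all_boot all_order all_algebra.
From mathcomp Require Import complex.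
From mathcomp Require Import all_classical all_reals all_analysis.

(* The projections P_n commute with the weight W, which is bijective on X_n (the
   iteration x := x + t (y - W x) converges), so iota (X_n) is closed in the
   completion and P_n extends to its orthogonal projection Q_n there.  The pairs
   in H W with first component in iota (X_n) suffice: if (y, w)
   lies in the adjoint of H W, testing against W^-1 P_n a for a in the domain of
   H shows that (Q_n y, Q_n w) lies in H^* W, and Q_n tends strongly to 1.  The
   converse inclusion is the symmetry of W and of P_n, as adjoints are closed. *)

Set Implicit Arguments.
Unset Strict Implicit.
Unset Printing Implicit Defensive.

Import Order.TTheory GRing.Theory Num.Theory.
Import numFieldNormedType.Exports.

Local Open Scope classical_set_scope.
Local Open Scope ring_scope.

(** * Inner products over real or complex scalars *)

Section InnerProduct.
Context {R : realType} {s : scalars} {X : hilbertType R s}.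
Implicit Types (a : scalar_field R s) (x y z : X).

(** In the order of [R[i]], being nonnegative includes having zero imaginary part. *)
Lemma scalar_conj_ge0 a : 0 <= a -> scalar_conj a = a.
Proof. 
case: s a => //= a; rewrite lecE => /andP[/eqP a0 _].
by case: a a0 => u v /= ->; rewrite oppr0.
Qed.

Lemma innerBl x y z : inner (x - y) z = inner x z - inner y z.
Proof. exact: linearBl. Qed.
Lemma innerDl x y z : inner (x + y) z = inner x z + inner y z.
Proof. exact: linearDl. Qed.
Lemma innerBr x y z : inner z (x - y) = inner z x - inner z y.
Proof. exact: linearBr. Qed.
Lemma innerDr x y z : inner z (x + y) = inner z x + inner z y.
Proof. exact: linearDr. Qed.
Lemma innerZl a y z : inner (a *: y) z = a * inner y z.
Proof. by rewrite linearZl_LR. Qed.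
Lemma innerZr a y z : inner y (a *: z) = scalar_conj a * inner y z.
Proof. by rewrite linearZr_LR. Qed.
Lemma innerC x y : inner x y = scalar_conj (inner y x).
Proof. by rewrite hermitian_subproof expr0 mul1r. Qed.

Lemma inner_eq0 x : inner x x = 0 -> x = 0.
Proof. by rewrite -sqr_norm_inner => /eqP; rewrite sqrf_eq0 normr_eq0 => /eqP. Qed.

Lemma inner_orthC x y : inner x y = 0 -> inner y x = 0.
Proof. by move=> xy0; rewrite innerC xy0 scalar_conj_ge0. Qed.

Lemma pythagoras x y : inner x y = 0 -> `|x + y| ^+ 2 = `|x| ^+ 2 + `|y| ^+ 2.
Proof.
move=> xy0; rewrite !sqr_norm_inner innerDl !innerDr xy0 (inner_orthC xy0).
by rewrite addr0 add0r.
Qed.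

Lemma pythagoras_le x y : inner x y = 0 -> `|x| <= `|x + y|.
Proof.
move=> xy0; rewrite -(@ler_pXn2r _ 2) ?nnegrE// (pythagoras xy0).
by rewrite lerDl exprn_ge0.
Qed.

Lemma cauchy_schwarz x y : `|inner x y| <= `|x| * `|y|.
Proof.
have [->|y0] := eqVneq y 0; first by rewrite linear0r !normr0 mulr0.
(* [a *: y] is the orthogonal projection of [x] onto the line of [y], so Pythagoras gives
   [|a *: y| <= |x|]. *)
pose a := inner x y / `|y| ^+ 2.
have n0 : `|y| != 0 by rewrite normr_eq0.
have o : inner (a *: y) (x - a *: y) = 0.
  apply: inner_orthC; rewrite innerZr innerBl innerZl -sqr_norm_inner.
  by rewrite divfK ?sqrf_eq0// subrr mulr0.
have := pythagoras_le o; rewrite addrC subrK normrZ normrM normfV normrX normr_id.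
rewrite -mulrA expr2 invfM -mulrA mulVf// mulr1 ler_pdivrMr//.
by rewrite lt0r n0 normr_ge0.
Qed.

Lemma cvg_innerl {T} (F : set_system T) {FF : Filter F} (f : T -> X) (x : X) y :
  f @ F --> x -> inner (f t) y @[t --> F] --> inner x y.
Proof.
move=> /cvgrPdist_le fx; apply/cvgrPdist_le => e e0.
(* The added 1 makes the division legitimate when [y = 0]. *)
have y1 : 0 < `|y| + 1 by rewrite ltr_wpDl.
near=> t; rewrite -innerBl; apply: le_trans (cauchy_schwarz _ _) _.
apply: (@le_trans _ _ (e / (`|y| + 1) * (`|y| + 1))); last by rewrite divfK ?gt_eqF.
apply: ler_pM => //; last by rewrite lerDl.
by near: t; apply: fx; rewrite divr_gt0.
Unshelve. all: by end_near. Qed.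

Lemma cvg_innerr {T} (F : set_system T) {FF : Filter F} (f : T -> X) (x : X) y :
  f @ F --> x -> inner y (f t) @[t --> F] --> inner y x.
Proof.
move=> /cvgrPdist_le fx; apply/cvgrPdist_le => e e0.
have y1 : 0 < `|y| + 1 by rewrite ltr_wpDl.
near=> t; rewrite -innerBr; apply: le_trans (cauchy_schwarz _ _) _.
apply: (@le_trans _ _ ((`|y| + 1) * (e / (`|y| + 1)))); last first.
  by rewrite mulrC divfK ?gt_eqF.
apply: ler_pM => //; first by rewrite lerDl.
by near: t; apply: fx; rewrite divr_gt0.
Unshelve. all: by end_near. Qed.

End InnerProduct.

(** * Geometric decay, limits by completeness, and density *)

Lemma real_expr_lt (R : realType) (q C e : R) :
  0 <= q < 1 -> 0 < e -> exists k, q ^+ k * C < e.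
Proof.
move=> /andP[q0 q1] e0.
have : geometric C q k @[k --> \oo] --> (0 : R).
  by apply: cvg_geometric; rewrite ger0_norm.
move=> /cvgrPdist_lt/(_ e e0)[k _ /(_ k (leqnn k))] /=.
rewrite sub0r normrN => /(le_lt_trans (ler_norm _)); rewrite mulrC.
by exists k.
Qed.

(** Nonnegative complex scalars are real, which reduces the complex case to the real one. *)
Lemma scalar_expr_lt (R : realType) (s : scalars) (q C e : scalar_field R s) :
  0 <= q < 1 -> 0 <= C -> 0 < e -> exists k, q ^+ k * C < e.
Proof.
case: s q C e => q C e /=; first by move=> + _; exact: real_expr_lt.
move=> /andP[q0 q1] C0 e0.
have realE (a : R[i]) : 0 <= a -> a = (complex.Re a)%:C%C.
  by case: a => u v; rewrite lecE => /andP[/eqP /= -> _].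
have [||k ltk] := @real_expr_lt R (complex.Re q) (complex.Re C) (complex.Re e).
- by move: q0 q1; rewrite lecE ltcE => /andP[_ ->] /andP[_ ->].
- by move: e0; rewrite ltcE => /andP[_ ->].
exists k; rewrite (realE q q0) (realE C C0) (realE e (ltW e0)).
by rewrite -rmorphXn -rmorphM ltcR.
Qed.

(* The filter on T whose members contain g^-1(B) `&` S for a neighbourhood B of
   z replaces a sequence a_k in S with g (a_k) --> z. *)
Lemma approximating_filter (K : numFieldType) (T : Type)
    (X : completeNormedModType K) (Z : normedModType K)
    (S : set T) (g : T -> Z) (p : T -> X) (c : K) (z : Z) :
  0 < c ->
  (forall a b, S a -> S b -> c * `|p a - p b| <= `|g a - g b|) ->
  (forall e, 0 < e -> exists2 a, S a & `|z - g a| < e) ->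
  exists F : set_system T,
    [/\ ProperFilter F, F S, g @ F --> z & exists l : X, p @ F --> l].
Proof.
move=> c0 gp gz.
pose F : set_system T :=
  fun A => \forall y \near z, forall a, S a -> g a = y -> A a.
have PF : ProperFilter F.
  split.
    move=> /nbhs_normP[e /= e0 /= be]; have [a Sa za] := gz e e0.
    exact: be za a Sa erefl.
  split.
  - by apply: nearW => y a.
  - move=> A B FA FB; rewrite /F.
    apply: (@filterS2 _ (nbhs z) _ _ _ _ _ FA FB) => y HA HB a Sa ay.
    by split; [exact: HA|exact: HB].
  - move=> A B AB FA; apply: (@filterS _ (nbhs z) _ _ _ _ FA) => y HA a Sa ay.
    exact/AB/HA.
exists F; split => //.
- by apply: nearW => y a.
- move=> A zA; apply: (@filterS _ (nbhs z) _ _ _ _ zA) => y Ay a _ gay.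
  by rewrite /preimage /= gay.
- apply/cvg_ex/cauchy_cvgP/cauchy_exP => e e0.
  (* Two points of [S] whose images lie within [c * e / 2] of [z] have images less than [c * e]
     apart, hence values of [p] less than [e] apart. *)
  have d0 : 0 < c * e / 2 by rewrite !mulr_gt0 ?invr_gt0.
  have [a Sa za] := gz _ d0; exists (p a).
  apply/nbhs_normP; exists (c * e / 2) => //= y zy b Sb gby.
  rewrite -ball_normE /= -(ltr_pM2l c0); apply: le_lt_trans (gp _ _ Sa Sb) _.
  rewrite [c * e]splitr (le_lt_trans (ler_distD z _ _))// distrC gby.
  exact: ltrD.
Qed.

Lemma dense_approx (K : numFieldType) (Z : normedModType K) (D : set Z) :
  dense D <-> forall z e, 0 < e -> exists2 a, D a & `|z - a| < e.
Proof.
split=> [dD z e e0|aD O [z Oz] oO].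
  have [|//|a [/= za Da]] := dD (ball_ Num.norm z e).
  - by exists z; rewrite /ball_/= subrr normr0.
  - by rewrite ball_normE; exact: ball_open.
  - by exists a.
have /nbhs_normP[e /= e0 be] : nbhs z O by exact: open_nbhs_nbhs.
by have [a Da za] := aD z e e0; exists a; split => //; exact: be.
Qed.

(** * Subspaces and orthogonal projections *)

Section Subspace.
Context {K : numFieldType} {E : lmodType K} {V : set E} (hV : is_subspace V).

Lemma subspaceB x y : V x -> V y -> V (x - y).
Proof. by move=> Vx Vy; rewrite addrC -scaleN1r; exact: hV.2. Qed.

End Subspace.

Section Projection.
Context {R : realType} {s : scalars} {X : hilbertType R s}.
Context {V : set X} {P : X -> X}.
Context (hV : is_subspace V) (hP : orthogonal_projection V P).

Lemma proj_mem x : V (P x). Proof. exact: (hP x).1. Qed.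

Lemma inner_projl x v : V v -> inner (P x) v = inner x v.
Proof. by move=> /(hP x).2/eqP; rewrite innerBl subr_eq0 => /eqP. Qed.

Lemma inner_projr x v : V v -> inner v (P x) = inner v x.
Proof. by move=> Vv; rewrite innerC inner_projl// -innerC. Qed.

Lemma inner_projC x y : inner (P x) y = inner x (P y).
Proof. by rewrite -(inner_projl x (proj_mem y)) (inner_projr y (proj_mem x)). Qed.

(** The difference [u - v] is itself an admissible test vector. Identities inside [V] are proved
    weakly this way. *)
Lemma subspace_inner_eq u v : V u -> V v ->
  (forall w, V w -> inner u w = inner v w) -> u = v.
Proof.
move=> Vu Vv uv; apply/eqP; rewrite -subr_eq0; apply/eqP/inner_eq0.
by rewrite innerBl uv ?subrr//; exact: subspaceB.
Qed.

Lemma proj_id x : V x -> P x = x.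
Proof.
move=> Vx; apply: subspace_inner_eq => // [|w]; first exact: proj_mem.
exact: inner_projl.
Qed.

Lemma projB x y : P (x - y) = P x - P y.
Proof.
apply: subspace_inner_eq => [||w Vw]; first exact: proj_mem.
  by apply: subspaceB => //; exact: proj_mem.
by rewrite innerBl !inner_projl// innerBl.
Qed.

(** [v - P x] lies in [V], hence is orthogonal to [P x - x]. *)
Lemma proj_dist x v : V v -> `|v - P x| <= `|v - x|.
Proof.
move=> Vv; rewrite (_ : v - x = (v - P x) + (P x - x)); last by rewrite addrA subrK.
apply/pythagoras_le; rewrite innerBr inner_projr ?subrr//.
by apply: subspaceB => //; exact: proj_mem.
Qed.

End Projection.

(** * The weight on a single subspace: symmetry, bounds, contraction *)

Section Weight.
Context {R : realType} {s : scalars} {X : hilbertType R s}.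
Context {W : set (X * X)} {V : nat -> set X} (hW : locally_finite_weight W V).

Lemma weight_subspace n : is_subspace (V n).
Proof. by have [_ [/(_ n)[]]] := hW. Qed.
Lemma weight_closed n : closed (V n).
Proof. by have [_ [/(_ n)[]]] := hW. Qed.

Lemma weight_mono m n : (m <= n)%N -> V m `<=` V n.
Proof.
move=> /subnK <-; elim: (n - m)%N => // k ih x /ih.
by have [_ [_ /(_ (k + m)%N) + _ _ _]] := hW; exact.
Qed.

Lemma weight_total n x : V n x -> exists2 y, W (x, y) & V n y.
Proof.
move=> Vx; have [_ [_ _ /(_ n)[dV WV] _ _]] := hW.
have [[u y] Wuy /= eux] := dV x Vx; rewrite eux in Wuy; exists y => //; exact: WV Vx.
Qed.

Lemma weight_mem n x y : W (x, y) -> V n x -> V n y.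
Proof. by have [_ [_ _ /(_ n)[_ WV] _ _]] := hW; exact: WV. Qed.

Lemma weight_linear a x x' y y' :
  W (x, y) -> W (x', y') -> W (a *: x + x', a *: y + y').
Proof. by have [[[[_ WL] _] _ _] _] := hW; exact: WL. Qed.

Lemma weightB x x' y y' : W (x, y) -> W (x', y') -> W (x - x', y - y').
Proof.
by move=> h h'; have := weight_linear (-1) h' h; rewrite !scaleN1r ![- _ + _]addrC.
Qed.

Lemma weight_sym x x' y y' :
  W (x, y) -> W (x', y') -> inner y x' = inner x y'.
Proof.
by have [[_ _ eW] _] := hW; move=> Wxy; rewrite -{1}eW => /(_ _ _ Wxy).
Qed.

Lemma weight_bounds n : exists M c : scalar_field R s, [/\ 0 < c, c <= M &
  forall x y, W (x, y) -> V n x ->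
    `|y| <= M * `|x| /\ c * `|x| ^+ 2 <= inner y x].
Proof.
have [_ [_ _ _ /(_ n)[[M hM] [c c0 hc]] _]] := hW.
(* The given [M] need not be nonnegative when [V n] is trivial. The bound [|M| + c] is positive and
   dominates [c], which later keeps the Richardson parameter [d] below 1. *)
exists (`|M| + c), c; split => // [|x y Wxy Vx]; first by rewrite lerDr.
split; last first.
  by rewrite sqr_norm_inner (weight_sym Wxy Wxy); exact: hc.
have le_yMx := hM x y Wxy Vx; rewrite (le_trans le_yMx)//.
(* The product dominates [|y|], so it is nonnegative and equals its own norm. *)
have -> : M * `|x| = `|M| * `|x|.
  by rewrite -[LHS]ger0_norm ?(le_trans _ le_yMx)// normrM normr_id.
by rewrite mulrDl lerDl mulr_ge0// ltW.
Qed.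

(** Cauchy-Schwarz gives [c |x|^2 <= <W x, x> <= |W x| |x|]; then divide by [|x|]. *)
Lemma weight_coercive n : exists2 c : scalar_field R s, 0 < c &
  forall x y, W (x, y) -> V n x -> c * `|x| <= `|y|.
Proof.
have [M [c [c0 _ hc]]] := weight_bounds n; exists c => // x y Wxy Vx.
have [->|x0] := eqVneq x 0; first by rewrite normr0 mulr0.
have nx0 : 0 < `|x| by rewrite normr_gt0.
rewrite -(ler_pM2r nx0) -mulrA -expr2; have [_ h] := hc _ _ Wxy Vx.
apply: (le_trans h); apply: le_trans (cauchy_schwarz y x).
rewrite -[X in X <= _]ger0_norm //; apply: le_trans h.
by rewrite mulr_ge0 ?exprn_ge0// ltW.
Qed.

(* t = c / M ^+ 2 gives `|r - t W r| ^+ 2 <= (1 - t c) `|r| ^+ 2, and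
   q = 1 - t c / 2 avoids the square root. *)
Lemma richardson_step n : exists t q : scalar_field R s, 0 <= q < 1 /\
  forall r v, W (r, v) -> V n r -> `|r - t *: v| <= q * `|r|.
Proof.
have [M [c [c0 cM hW']]] := weight_bounds n.
have M0 : 0 < M by exact: lt_le_trans cM.
pose t := c / M ^+ 2; pose d := t * c.
have t0 : 0 < t by rewrite divr_gt0// exprn_gt0.
have d0 : 0 < d by rewrite mulr_gt0.
have d1 : d <= 1.
  rewrite /d /t mulrAC -expr2 -expr_div_n exprn_ile1//.
    by rewrite divr_ge0// ltW.
  by rewrite ler_pdivrMr// mul1r.
have d2 : d / 2 < 1.
  by rewrite ltr_pdivrMr// mul1r (le_lt_trans d1)// ltr1n.
exists t, (1 - d / 2); split.
  by rewrite subr_ge0 (ltW d2) gtrBl divr_gt0.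
move=> r v Wrv Vr; have [vM rc] := hW' _ _ Wrv Vr.
have ct : scalar_conj t = t by rewrite scalar_conj_ge0// ltW.
rewrite -(@ler_pXn2r _ 2) ?nnegrE// ?mulr_ge0 ?subr_ge0 ?(ltW d2)//.
rewrite sqr_norm_inner innerBl !innerBr !innerZl !innerZr ct -!sqr_norm_inner.
rewrite -(weight_sym Wrv Wrv).
have tM : t * (t * `|v| ^+ 2) <= d * `|r| ^+ 2.
  apply: (@le_trans _ _ (t * (t * (M * `|r|) ^+ 2))).
    by rewrite !ler_pM2l// ler_pXn2r ?nnegrE// mulr_ge0// ltW.
  rewrite exprMn [t * (M ^+ 2 * _)]mulrA [t * M ^+ 2]divfK ?sqrf_eq0 ?gt_eqF//.
  by rewrite mulrA.
have td : d * `|r| ^+ 2 <= t * inner v r by rewrite /d -mulrA ler_pM2l.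
rewrite exprMn; set N := `|r| ^+ 2 in tM td *.
have N0 : 0 <= N by rewrite exprn_ge0.
(* Each of the two cross terms contributes at most [- d N] and the quadratic term at most [d N],
   leaving [(1 - d) N <= (1 - d / 2)^2 N]. *)
apply: (@le_trans _ _ (N - d * N - (d * N - d * N))).
  by apply: lerB; [rewrite lerD2l lerN2|exact: lerB].
rewrite subrr subr0 -[X in X - _]mul1r -mulrBl ler_wpM2r//.
rewrite sqrrB expr1n mul1r -[_ *+ 2]mulr_natr divfK ?pnatr_eq0//.
by rewrite lerDl exprn_ge0// divr_ge0// ltW.
Qed.

End Weight.

(** * Surjectivity of the weight on each subspace *)

Section WeightSurjective.
Context {R : realType} {s : scalars} {X : hilbertType R s}.
Context {W : set (X * X)} {V : nat -> set X} (hW : locally_finite_weight W V).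

(** Richardson iteration from 0: replacing [u] by [u + t (y - W u)] turns the residual [r = y - W u]
    into [r - t W r], which is smaller by the factor [q]. *)
Lemma weight_approx n y e : V n y -> 0 < e ->
  exists2 p, W p /\ V n p.1 & `|y - p.2| < e.
Proof.
move=> Vy e0; have [t [q [q01 hq]]] := richardson_step hW n.
have hV := weight_subspace hW n.
suff approx k : exists2 p, W p /\ V n p.1 & `|y - p.2| <= q ^+ k * `|y|.
  have [k ltk] := scalar_expr_lt q01 (normr_ge0 y) e0.
  by have [p Wp yp] := approx k; exists p => //; exact: le_lt_trans ltk.
elim: k => [|k [[u v] /= [Wuv Vu] yv]].
  have [z W0z _] := weight_total hW hV.1.
  exists (0, 0); last by rewrite /= subr0 expr0 mul1r.
  split; last exact: hV.1.
  by have := weightB hW W0z W0z; rewrite !subrr.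
have Vr : V n (y - v) by apply: subspaceB => //; exact: (weight_mem hW Wuv Vu).
have [w Wrw _] := weight_total hW Vr.
exists (t *: (y - v) + u, t *: w + v) => /=.
  split; first exact: (weight_linear hW _ Wrw Wuv).
  exact: hV.2.
rewrite [t *: w + v]addrC opprD addrA exprS -mulrA.
by apply: le_trans (hq _ _ Wrw Vr) _; rewrite ler_wpM2l//; case/andP: q01.
Qed.

(** Coercivity makes the approximate solutions Cauchy, and their limit [l] stays in the closed
    [V n]. Symmetry identifies [W l] with [y]: for [v] in [V n], [<W a, v> = <a, W v>] passes to the
    limit. *)
Lemma weight_surjective n y : V n y -> exists2 x, V n x & W (x, y).
Proof.
move=> Vy; have [c c0 hc] := weight_coercive hW n.
have hV := weight_subspace hW n.
(* The approximating objects are points of the graph: the first component is to converge because the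
   second does. *)
have hS (p r : X * X) : W p /\ V n p.1 -> W r /\ V n r.1 ->
    c * `|p.1 - r.1| <= `|p.2 - r.2|.
  case: p r => [u v] [u' v'] /= [Wuv Vu] [Wu'v' Vu'].
  by apply: hc (weightB hW Wuv Wu'v') (subspaceB hV Vu Vu').
have [F [PF FS Fy [l Fl]]] :=
  approximating_filter c0 hS (fun e e0 => weight_approx Vy e0).
have Vl : V n l.
  apply: (closed_cvg (V n) _ _ l Fl); first exact: (weight_closed hW).
  by apply: filterS FS => p [].
have [z Wlz Vz] := weight_total hW Vl; exists l => //.
rewrite (_ : y = z)//; apply: (subspace_inner_eq hV) => // v Vv.
have [w Wvw _] := weight_total hW Vv.
rewrite (weight_sym hW Wlz Wvw).
have lw : inner p.2 v @[p --> F] --> inner l w.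
  apply: cvg_trans (cvg_innerl (y := w) Fl); apply: near_eq_cvg.
  by apply: filterS FS => -[a b] [Wab _]; exact/esym/(weight_sym hW Wab Wvw).
exact: norm_cvg_unique (cvg_innerl (y := v) Fy) lw.
Qed.

End WeightSurjective.

(** * Embedding of the subspaces in the completion, and the projections Q_n *)

Section WeightedCompletion.
Context {R : realType} {s : scalars} {X Y : hilbertType R s}.
Context {W : set (X * X)} {V : nat -> set X} (hW : locally_finite_weight W V).
Context {P : nat -> X -> X} (hP : forall n, orthogonal_projection (V n) (P n)).
Context {iota : X -> Y} (hY : weighted_completion W (\bigcup_n V n) iota).

(** For [v] in [V n] also [W v] is in [V n], so [<W P_n x, v> = <P_n x, W v> = <x, W v> = <W x, v> =
    <P_n W x, v>]. *)
Lemma weight_proj n x y : W (x, y) -> W (P n x, P n y).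
Proof.
move=> Wxy; have hV := weight_subspace hW n.
have [z WPz Vz] := weight_total hW (proj_mem (hP n) x).
rewrite (_ : P n y = z)//; apply: (subspace_inner_eq hV) => // [|v Vv].
  exact: (proj_mem (hP n)).
have [w Wvw Vw] := weight_total hW Vv.
rewrite (weight_sym hW WPz Wvw) !(inner_projl (hP n))//.
exact: (weight_sym hW Wxy Wvw).
Qed.

Lemma embed_inner n m x y z : V n x -> V m y -> W (y, z) ->
  inner (iota x) (iota y) = inner x z.
Proof.
move=> Vx Vy Wyz; have [_ hi _] := hY.
by apply: (hi _ _ _ _ _ Wyz); [exists n|exists m].
Qed.

Lemma embedB n x y : V n x -> V n y -> iota (x - y) = iota x - iota y.
Proof.
move=> Vx Vy; have [hi _ _] := hY.
by rewrite addrC -scaleN1r hi ?scaleN1r 1?addrC//; exists n.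
Qed.

Lemma sqr_norm_embed n x y : V n x -> W (x, y) -> `|iota x| ^+ 2 = inner y x.
Proof.
move=> Vx Wxy.
by rewrite sqr_norm_inner (embed_inner Vx Vx Wxy) (weight_sym hW Wxy Wxy).
Qed.

Lemma embed_lower n : exists2 c : scalar_field R s, 0 < c &
  forall x, V n x -> c * `|x| <= `|iota x|.
Proof.
have [M [c [c0 _ hc]]] := weight_bounds hW n.
have c1 : 0 < 1 + c by rewrite addr_gt0.
(* Since [d <= 1] and [d <= c], also [d^2 <= c]; [d] stands in for the square root of [c]. *)
pose d := c / (1 + c); have d0 : 0 < d by rewrite divr_gt0.
have d1 : d <= 1 by rewrite ler_pdivrMr// mul1r lerDr.
have dc : d <= c by rewrite ler_pdivrMr// mulrDr mulr1 lerDl mulr_ge0// ltW.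
exists d => // x Vx; have [y Wxy _] := weight_total hW Vx.
rewrite -(@ler_pXn2r _ 2) ?nnegrE ?(mulr_ge0 (ltW d0))// (sqr_norm_embed Vx Wxy).
apply: le_trans (hc _ _ Wxy Vx).2; rewrite exprMn ler_wpM2r ?exprn_ge0//.
by apply: le_trans dc; rewrite expr2 ler_piMr// ltW.
Qed.

Lemma embed_upper n : exists2 C : scalar_field R s, 0 < C &
  forall x, V n x -> `|iota x| <= C * `|x|.
Proof.
have [M [c [c0 cM hc]]] := weight_bounds hW n.
have M0 : 0 < M by exact: lt_le_trans cM.
(* [1 + M] stands in for the square root of [M], as [M <= (1 + M)^2]. *)
have C0 : 0 < 1 + M by rewrite addr_gt0.
exists (1 + M) => // x Vx; have [y Wxy _] := weight_total hW Vx.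
have [yM ge] := hc _ _ Wxy Vx.
rewrite -(@ler_pXn2r _ 2) ?nnegrE ?(mulr_ge0 (ltW C0))// (sqr_norm_embed Vx Wxy).
have i0 : 0 <= inner y x by rewrite (le_trans _ ge)// mulr_ge0 ?exprn_ge0// ltW.
rewrite -[X in X <= _]ger0_norm//; apply: le_trans (cauchy_schwarz _ _) _.
apply: le_trans (ler_wpM2r (normr_ge0 x) yM) _.
rewrite exprMn -mulrA -expr2 ler_wpM2r ?exprn_ge0//.
rewrite sqrrD expr1n mul1r mulr2n addrA [1 + _]addrC -!addrA lerDl.
by rewrite !addr_ge0 ?exprn_ge0// ltW.
Qed.

(** [W P_n u] lies in [V n], so [u - P_n u] is orthogonal to it in [X]; thus [u - P_n u] and [P_n u]
    are orthogonal for the weighted product. *)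
Lemma embed_proj_contract n m u : V m u -> `|iota (P n u)| <= `|iota u|.
Proof.
move=> Vu; pose k := maxn m n.
have Vku : V k u by apply: weight_mono hW _ _ _ _ Vu; exact: leq_maxl.
have VPu := proj_mem (hP n) u.
have VkPu : V k (P n u) by apply: weight_mono hW _ _ _ _ VPu; exact: leq_maxr.
have [w Ww Vw] := weight_total hW VPu.
rewrite (_ : iota u = iota (P n u) + iota (u - P n u)); last first.
  by rewrite (embedB Vku VkPu) addrC subrK.
apply/pythagoras_le/inner_orthC.
have hV := weight_subspace hW k.
rewrite (embed_inner (subspaceB hV Vku VkPu) VPu Ww).
by rewrite innerBl (inner_projl (hP n))// subrr.
Qed.

(** Here [iota u] is Q_n y. When [iota a] tends to [y], the vectors [P_n a] are Cauchy in [X],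
    because P_n contracts the weighted norm and [iota] is bounded below on [V n]; [u] is their
    limit. *)
Lemma embed_proj_exists n (y : Y) :
  exists2 u, V n u & forall v, V n v -> inner (iota u) (iota v) = inner y (iota v).
Proof.
have [_ _ /dense_approx dY] := hY; have [c c0 hc] := embed_lower n.
have hPg (a b : X) : (\bigcup_m V m) a -> (\bigcup_m V m) b ->
    c * `|P n a - P n b| <= `|iota a - iota b|.
  move=> [k _ Va] [m _ Vb]; pose l := maxn k m.
  have {}Va : V l a by apply: weight_mono hW _ _ _ _ Va; exact: leq_maxl.
  have {}Vb : V l b by apply: weight_mono hW _ _ _ _ Vb; exact: leq_maxr.
  rewrite -(projB (weight_subspace hW n) (hP n)).
  apply: le_trans (hc _ (proj_mem (hP n) _)) _.
  rewrite -(embedB Va Vb); apply: embed_proj_contract.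
  exact: (subspaceB (weight_subspace hW l) Va Vb).
have ay e : 0 < e -> exists2 a, (\bigcup_m V m) a & `|y - iota a| < e.
  by move=> /(dY y)[_ [a Ua <-] ya]; exists a.
have [F [PF FS Fy [l Fl]]] := approximating_filter c0 hPg ay.
have Vl : V n l.
  apply: (closed_cvg (V n) _ _ l Fl); first exact: (weight_closed hW).
  by apply: nearW => a; exact: (proj_mem (hP n)).
exists l => // v Vv; have [w Wvw Vw] := weight_total hW Vv.
rewrite (embed_inner Vl Vv Wvw).
have lw : inner (P n a) w @[a --> F] --> inner y (iota v).
  apply: cvg_trans (cvg_innerl (y := iota v) Fy); apply: near_eq_cvg.
  apply: filterS FS => a [m _ Va].
  by rewrite (inner_projl (hP n))// (embed_inner Va Vv Wvw).
exact: norm_cvg_unique (cvg_innerl (y := w) Fl) lw.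
Qed.

End WeightedCompletion.

(** An adjoint is an intersection of zero sets of continuous functions [f], one for each pair of
    [A]. *)
Lemma adjoint_closed (R : realType) (s : scalars) (X : hilbertType R s)
    (A : set (X * X)) : closed (adjoint A).
Proof.
move=> p clp x y Axy; apply/eqP; rewrite -subr_eq0; apply/eqP.
pose f (q : X * X) := inner y q.1 - inner x q.2.
have cf : continuous f.
  by move=> q; apply: cvgB; apply: cvg_innerr; [exact: cvg_fst|exact: cvg_snd].
have clf : closed (f @^-1` [set 0]).
  apply: closed_comp => [q _|]; first exact: cf.
  exact/accessible_closed_set1/hausdorff_accessible/norm_hausdorff.
apply: (clf p); apply: closure_subset clp => q hq.
by rewrite /f /= (hq x y Axy) subrr.
Qed.

(** * Weighted operators: the two inclusions and density *)

Section WeightedOperator.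
Context {R : realType} {s : scalars} {X Y : hilbertType R s}.
Context {W : set (X * X)} {V : nat -> set X} (hW : locally_finite_weight W V).
Context {P : nat -> X -> X} (hP : forall n, orthogonal_projection (V n) (P n)).
Context {iota : X -> Y} (hY : weighted_completion W (\bigcup_n V n) iota).
Implicit Types K : set (X * X).

Let U := \bigcup_n V n.

(** The sequence [P m x] is constant from [m = n] on. *)
Lemma represents_embed n x : V n x -> represents U iota (fun m => P m x) (iota x).
Proof.
move=> Vx; split=> [m|]; first by exists m => //; exact: (proj_mem (hP m)).
apply: cvg_near_cst; exists n => // m /= nm.
rewrite (proj_id (weight_subspace hW m) (hP m))//.
exact: (weight_mono hW nm).
Qed.

(** From [m = n] on, [<iota (P_m x), iota v> = <P_m x, W v> = <x, W v>]. Products in the completion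
    against [iota v] thus become products in [X]. *)
Lemma represents_inner n x (y : Y) v w : represents U iota (fun m => P m x) y ->
  V n v -> W (v, w) -> inner y (iota v) = inner x w.
Proof.
move=> [_ xy] Vv Wvw.
have : inner (iota (P m x)) (iota v) @[m --> \oo] --> inner x w.
  apply: cvg_near_cst; exists n => // m /= nm.
  rewrite (embed_inner hY (proj_mem (hP m) x) Vv Wvw) (inner_projl (hP m))//.
  exact/(weight_mono hW nm)/(weight_mem hW Wvw Vv).
by move=> /(norm_cvg_unique (cvg_innerl (y := iota v) xy)).
Qed.

Lemma weighted_operator_embed K n m x y z :
  V n x -> V m z -> W (x, y) -> K (y, z) ->
  weighted_operator W V P iota K (iota x, iota z).
Proof.
move=> Vx Vz Wxy Kyz; exists x, y, z; split => //.
  exact: (represents_embed Vx).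
exact: (represents_embed Vz).
Qed.

(** Strong convergence of Q_n to the identity: [iota u] is the best approximation of [y] in
    [iota (V n)], and these spaces increase to a dense union. *)
Lemma embed_proj_cvg (y : Y) e : 0 < e -> exists N, forall n u, (N <= n)%N ->
  V n u -> (forall v, V n v -> inner (iota u) (iota v) = inner y (iota v)) ->
  `|y - iota u| < e.
Proof.
move=> e0; have [_ _ /dense_approx/(_ y e e0)[_ [a [N _ Va] <-] ya]] := hY.
exists N => n u Nn Vu hu; apply: le_lt_trans ya.
have {}Va := weight_mono hW Nn Va; have hV := weight_subspace hW n.
rewrite (_ : y - iota a = (y - iota u) + (iota u - iota a)); last first.
  by rewrite addrA subrK.
apply/pythagoras_le; rewrite -(embedB hY Vu Va) innerBl hu ?subrr//.
exact: (subspaceB hV Vu Va).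
Qed.

Lemma weighted_adjoint_sub H :
    (forall n x y, H (x, y) -> H (P n x, P n y)) ->
  weighted_operator W V P iota (adjoint H) `<=`
  adjoint (weighted_operator W V P iota H).
Proof.
move=> hPH [yt wt] [x' [y' [z' [Wx' Hy' ry rw]]]] xt zt.
move=> [x [y [z [Wx Hyz rx rz]]]] /=.
(* Truncation by P_n moves everything into [X]: [<z, W P_n x'> = <P_n z, y'> = <P_n y, z'> = <x, W
   P_n z'>], where the middle equality applies the adjoint relation to the pair [(P_n y, P_n z)] of
   [H]. *)
have hn n : inner zt (iota (P n x')) = inner xt (iota (P n z')).
  have [w Ww _] := weight_total hW (proj_mem (hP n) z').
  rewrite (represents_inner rz (proj_mem (hP n) x') (weight_proj hW hP n Wx')).
  rewrite (represents_inner rx (proj_mem (hP n) z') Ww).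
  rewrite -(weight_sym hW Wx Ww).
  rewrite -!(inner_projC (hP n)).
  exact: Hy' (hPH n _ _ Hyz).
have lim : inner zt (iota (P n x')) @[n --> \oo] --> inner xt wt.
  by rewrite (funext hn); exact: (cvg_innerr rw.2).
exact: norm_cvg_unique (cvg_innerr (y := zt) ry.2) lim.
Qed.

Lemma adjoint_weighted_sub H :
    (forall n x y, H (x, y) -> H (P n x, P n y)) ->
  adjoint (weighted_operator W V P iota H) `<=`
  closure (weighted_operator W V P iota (adjoint H)).
Proof.
move=> hPH [y w] hyw.
(* With [iota u] = Q_n y and [iota v] = Q_n w, the claim reduces to [<b, W u> = <a, v>] for every
   pair [(a, b)] of [H]. *)
have key n u v : V n u -> V n v ->
    (forall a, V n a -> inner (iota u) (iota a) = inner y (iota a)) ->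
    (forall a, V n a -> inner (iota v) (iota a) = inner w (iota a)) ->
  weighted_operator W V P iota (adjoint H) (iota u, iota v).
  move=> Vu Vv hu hv.
  have [u' Wu Vu'] := weight_total hW Vu; have [v' Wv Vv'] := weight_total hW Vv.
  apply: (weighted_operator_embed Vu Vv Wu) => a b Hab /=.
  have VPa := proj_mem (hP n) a; have VPb := proj_mem (hP n) b.
  (* [x] is the preimage of [P_n a] under [W], so [(iota x, iota (P_n b))] is a pair of the weighted
     [H] against which [(y, w)] can be tested. *)
  have [x Vx WxP] := weight_surjective hW VPa.
  have := hyw _ _ (weighted_operator_embed Vx VPb WxP (hPH n _ _ Hab)).
  rewrite /= [LHS]innerC -hu// -innerC [RHS]innerC -hv// -innerC.
  rewrite (embed_inner hY VPb Vu Wu) (embed_inner hY Vx Vv Wv).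
  by rewrite -(weight_sym hW WxP Wv) !(inner_projl (hP n)).
move=> B [[B1 B2] /= [/nbhs_normP[e1 /= e10 yB1] /nbhs_normP[e2 /= e20 wB2]] B12].
have [N1 hN1] := embed_proj_cvg y e10; have [N2 hN2] := embed_proj_cvg w e20.
pose n := maxn N1 N2.
have [u Vu hu] := embed_proj_exists hW hP hY n y.
have [v Vv hv] := embed_proj_exists hW hP hY n w.
exists (iota u, iota v); split; first exact: key Vu Vv hu hv.
apply: B12; split => /=.
  by apply: yB1; apply: hN1 Vu hu; exact: leq_maxl.
by apply: wB2; apply: hN2 Vv hv; exact: leq_maxr.
Qed.

(** Ensures that the adjoint in the completion is an operator. To approximate [iota u] with [u] in
    [V n], approximate [W u] by [a'] in the domain of [H] and take the preimage of [P_n a'] under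
    [W]. *)
Lemma weighted_operator_dense H : densely_defined H ->
    (forall n x y, H (x, y) -> H (P n x, P n y)) ->
  densely_defined (weighted_operator W V P iota H).
Proof.
move=> /dense_approx dH hPH; apply/dense_approx => y e e0.
have [_ _ /dense_approx dY] := hY.
have e20 : 0 < e / 2 by rewrite divr_gt0.
have [_ [u [n _ Vu] <-] yu] := dY y _ e20.
have [c c0 hc] := weight_coercive hW n; have [C C0 hC] := embed_upper hW hY n.
have [u' Wu Vu'] := weight_total hW Vu.
(* The radius comes from [|iota (u - x)| <= C |u - x| <= (C / c) |W u - P_n a'| <= (C / c) |W u -
   a'|]. *)
have d0 : 0 < e / 2 * c / C by rewrite divr_gt0// mulr_gt0.
have [a [[a' b] Hab /= <-] ua] := dH u' _ d0.
have VPa := proj_mem (hP n) a'; have VPb := proj_mem (hP n) b.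
have [x Vx WxP] := weight_surjective hW VPa.
exists (iota x).
  exists (iota x, iota (P n b)) => //.
  exact: weighted_operator_embed Vx VPb WxP (hPH n _ _ Hab).
have hV := weight_subspace hW n.
rewrite [e]splitr (le_lt_trans (ler_distD (iota u) _ _))// ltrD//.
rewrite -(embedB hY Vu Vx).
apply: le_lt_trans (hC _ (subspaceB hV Vu Vx)) _.
rewrite -ltr_pdivlMl// -(ltr_pM2l c0).
apply: le_lt_trans (hc _ _ (weightB hW Wu WxP) (subspaceB hV Vu Vx)) _.
apply: le_lt_trans (proj_dist hV (hP n) a' Vu') _; rewrite (lt_le_trans ua)//.
by rewrite mulrC mulrA [c * _]mulrC.
Qed.

End WeightedOperator.

(* W is the weight, V the corresponding subspaces, (XW, iota) the completion. *)
Theorem theorem4p15 (R : realType) (s : scalars) (X : hilbertType R s)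
    (W : set (X * X)) (V : nat -> set X)
    (hW : locally_finite_weight W V)
    (P : nat -> X -> X)
    (hP : forall n, orthogonal_projection (V n) (P n))
    (XW : hilbertType R s) (iota : X -> XW)
    (hXW : weighted_completion W (\bigcup_n V n) iota)
    (H : set (X * X))
    (hH : linear_operator H)
    (hHd : densely_defined H)
    (hPH : forall n x y, H (x, y) -> H (P n x, P n y))
    (hHV : forall n x y, H (x, y) -> V n x -> V n y) :
  densely_defined (weighted_operator W V P iota H) /\
  adjoint (weighted_operator W V P iota H) =
    closure (weighted_operator W V P iota (adjoint H)).
Proof.
split; first exact: (weighted_operator_dense hW hP hXW).
apply/seteqP; split; first exact: (adjoint_weighted_sub hW hP hXW).
move=> p clp; apply: (@adjoint_closed _ _ _ (weighted_operator W V P iota H)).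
by apply: closure_subset clp; exact: (weighted_adjoint_sub hW hP hXW).
Qed.
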